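(* Let $\rho,\tau,\zeta\in\mathbb R\cup\{\infty\}$. Then the following matrix identity holds: $$M_\zeta M_\tau M_\rho=M_{\rho\,\square\,\tau^{\boxminus}\,\square\,\zeta}.$$
   Context: For $\rho\in\mathbb R$, $$M_\rho=\frac1{1-\rho+\rho^2}\begin{pmatrix}\rho&1-\rho&\rho(\rho-1)\\1-\rho&\rho(\rho-1)&\rho\\\rho(\rho-1)&\rho&1-\rho\end{pmatrix},\qquad M_\infty=\begin{pmatrix}0&0&1\\0&1&0\\1&0&0\end{pmatrix}.$$ The commutative group operation $\square$ on $\mathbb R\cup\{\infty\}$ (identity $0$): for $\rho,\tau\in\mathbb R$, $\rho\,\square\,\tau=\frac{\rho+\tau-\rho\tau}{1-\rho\tau}$ if $\rho\tau\ne1$ and $\rho\,\square\,\tau=\infty$ if $\rho\tau=1$; $\rho\,\square\,\infty=\infty\,\square\,\rho=1-\frac1\rho$ for $\rho\in\mathbb R\setminus\{0\}$; $0\,\square\,\infty=\infty\,\square\,0=\infty$; $\infty\,\square\,\infty=1$. The inverse of $\tau$ is denoted $\tau^{\boxminus}$: $\tau^{\boxminus}=\frac{\tau}{\tau-1}$ for $\tau\in\mathbb R\setminus\{1\}$, $1^{\boxminus}=\infty$, $\infty^{\boxminus}=1$. *)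

(* Defs.v *)
From mathcomp Require Import all_boot all_order all_algebra.
From mathcomp Require Import reals.
From mathcomp Require Import ring lra.

Set Implicit Arguments.
Unset Strict Implicit.
Unset Printing Implicit Defensive.

Import Order.TTheory GRing.Theory Num.Theory.
Local Open Scope ring_scope.

(* R together with a single, unsigned point at infinity:
   [Some x] is the real number x and [None] is the point at infinity. *)
Definition pline (R : realType) : Type := option R.

Definition boxplus (R : realType) (a b : pline R) : pline R :=
  match a, b with
  | Some x, Some y =>
      if x * y == 1 then None else Some ((x + y - x * y) / (1 - x * y))
  | Some x, None | None, Some x =>
      if x == 0 then None else Some (1 - 1 / x)
  | None, None => Some 1
  end.

Definition boxinv (R : realType) (a : pline R) : pline R :=
  match a with
  | Some x => if x == 1 then None else Some (x / (x - 1))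
  | None => Some 1
  end.

Notation "a [+] b" := (boxplus a b) (at level 50, left associativity).

Definition mx_of_rows (R : realType) (rows : seq (seq R)) : 'M[R]_3 :=
  \matrix_(i < 3, j < 3) nth 0 (nth [::] rows i) j.

Definition Mbox (R : realType) (a : pline R) : 'M[R]_3 :=
  match a with
  | Some x =>
      (1 / (1 - x + x ^+ 2)) *:
      mx_of_rows [:: [:: x;           1 - x;       x * (x - 1)];
                     [:: 1 - x;       x * (x - 1); x];
                     [:: x * (x - 1); x;           1 - x]]
  | None =>
      mx_of_rows [:: [:: 0; 0; 1];
                     [:: 0; 1; 0];
                     [:: 1; 0; 0]]
  end.

Section GroupLaws.
Variable R : realType.
Implicit Types a b c : pline R.

Lemma boxplusC a b : a [+] b = b [+] a.
Proof.
case: a b => [x|] [y|] //=.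
by rewrite [y * x]mulrC [y + x]addrC.
Qed.

Lemma box0plus a : Some 0 [+] a = a.
Proof.
case: a => [x|] /=; last by rewrite eqxx.
by rewrite mul0r eq_sym oner_eq0 add0r !subr0 divr1.
Qed.

(* Homogeneous coordinates: a = X / Y, with Y = 0 at infinity. *)
Let rep a (X Y : R) : Prop :=
  match a with
  | Some x => Y != 0 /\ X = x * Y
  | None => Y = 0 /\ X != 0
  end.

Let rep_ex a : exists X Y, rep a X Y.
Proof.
by case: a => [x|]; [exists x, 1 | exists 1, 0];
  rewrite /= ?mulr1 oner_neq0.
Qed.

Let rep_inj a b X Y Z W : rep a X Y -> rep b Z W -> X * W = Z * Y -> a = b.
Proof.
case: a b => [x|] [y|] //= [h1 h2] [h3 h4]; subst => e.
- by congr Some; apply: (mulIf h1); apply: (mulIf h3); rewrite e; ring.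
- by move/eqP: e; rewrite mulr0 eq_sym mulf_eq0 (negPf h1) (negPf h4).
- by move/eqP: e; rewrite mulr0 mulf_eq0 (negPf h2) (negPf h3).
Qed.

Let rep_plus a b X Y Z W : rep a X Y -> rep b Z W ->
  rep (a [+] b) (X * W + Z * Y - X * Z) (Y * W - X * Z).
Proof.
case: a b => [x|] [y|] /= [h1 h2] [h3 h4]; subst.
- have -> : Y * W - x * Y * (y * W) = (1 - x * y) * (Y * W) by ring.
  have -> : x * Y * W + y * W * Y - x * Y * (y * W)
          = (x + y - x * y) * (Y * W) by ring.
  case: eqVneq => /= h; split.
  + by rewrite h subrr mul0r.
  + rewrite !mulf_neq0 //; apply/eqP => e.
    have e2 : y = 1 - x by lra.
    by subst; nra.
  + by rewrite !mulf_neq0 // subr_eq0 eq_sym.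
  + by field; rewrite subr_eq0 eq_sym.
- case: eqVneq => /= h; split; subst.
  + by ring.
  + have -> : 0 * Y * 0 + Z * Y - 0 * Y * Z = Z * Y by ring.
    by rewrite mulf_neq0.
  + by rewrite mulr0 sub0r oppr_eq0 !mulf_neq0.
  + by field.
- case: eqVneq => /= h; split; subst.
  + by ring.
  + have -> : X * W + 0 * W * 0 - X * (0 * W) = X * W by ring.
    by rewrite mulf_neq0.
  + by rewrite mul0r sub0r oppr_eq0 !mulf_neq0.
  + by field.
- by split; [rewrite mulr0 sub0r oppr_eq0 mulf_neq0 | ring].
Qed.

Let rep_inv a X Y : rep a X Y -> rep (boxinv a) X (X - Y).
Proof.
case: a => [x|] /= [h1 h2]; subst; last by rewrite subr0 mul1r.
case: eqVneq => /= h; subst; first by rewrite mul1r subrr.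
have -> : x * Y - Y = (x - 1) * Y by ring.
have h' : x - 1 != 0 by rewrite subr_eq0.
by split; [rewrite mulf_neq0 | field].
Qed.

Lemma boxplusA a b c : a [+] (b [+] c) = a [+] b [+] c.
Proof.
have [X [Y ra]] := rep_ex a; have [Z [W rb]] := rep_ex b.
have [U [V rc]] := rep_ex c.
apply: (rep_inj (rep_plus ra (rep_plus rb rc)) (rep_plus (rep_plus ra rb) rc)).
by ring.
Qed.

Lemma boxplusV a : a [+] boxinv a = Some 0.
Proof.
have [X [Y ra]] := rep_ex a.
have r0 : rep (Some 0) 0 1 by rewrite /= mul0r oner_neq0.
by apply: (rep_inj (rep_plus ra (rep_inv ra)) r0); ring.
Qed.

End GroupLaws.

(* Main.v *)
Require Import Defs.
From mathcomp Require Import all_boot all_order all_algebra.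
From mathcomp Require Import reals.
From mathcomp Require Import ring.

(** Let [w] be a primitive cube root of unity, and attach to a point
    [a = X / Y] of the projective line the number [u = Y + X w], defined up to
    a nonzero real factor.  The square of its modulus is [X^2 - X Y + Y^2],
    which vanishes only at [X = Y = 0].  Since [w^2 = - 1 - w], multiplying two
    such numbers gives
      [(Y + X w)(W + Z w) = (Y W - X Z) + (X W + Z Y - X Z) w],
    so the operation [+] is multiplication of complex numbers modulo real
    scalars ([hpoint_plus]), and the inverse in the group is complex
    conjugation ([hpoint_inv]).

    In homogeneous coordinates the matrix attached to [a] has entry
    [c_((i + j) mod 3)] in position [(i, j)], where [c_0], [c_1], [c_2] are
    [X Y], [Y (Y - X)], [X (X - Y)] divided by the square of the modulus
    ([Mbox_hpoint]).  It fixes the vector [(1, 1, 1)], and because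
      [c_0 + c_1 w + c_2 w^2 = w * conj(u)^2 / |u|^2 = w * conj(u) / u],
    it is, on the plane orthogonal to that vector, a reflection whose axis is
    governed by the argument of [u].  A product of three reflections of a plane
    is again a reflection, whose argument is the alternating sum of the three;
    alternating means that the number attached to the middle factor is
    conjugated, that is, inverted in the group.

    Clearing denominators turns this into a polynomial identity between
    matrices of quadratic forms ([Mhom_mul3]); the denominators match because
    the modulus is multiplicative. *)

Set Implicit Arguments.
Unset Strict Implicit.
Unset Printing Implicit Defensive.

Import Order.TTheory GRing.Theory Num.Theory.
Local Open Scope ring_scope.

Section HomogeneousCoordinates.
Variable R : realType.
Implicit Types (a : pline R) (X Y Z W U V : R).

Definition hpoint X Y : pline R := if Y == 0 then None else Some (X / Y).

(** The norm of [Y + X w], for a primitive cube root of unity [w]; its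
    nonvanishing is how the pair [(X, Y)] is required to be nonzero. *)
Definition eisnorm X Y : R := X ^+ 2 - X * Y + Y ^+ 2.

Definition Mhom X Y : 'M[R]_3 :=
  mx_of_rows [:: [:: X * Y;       Y * (Y - X); X * (X - Y)];
                 [:: Y * (Y - X); X * (X - Y); X * Y];
                 [:: X * (X - Y); X * Y;       Y * (Y - X)]].

Lemma eisnorm_neq0 X Y : Y != 0 -> eisnorm X Y != 0.
Proof.
move=> Y0; rewrite gt_eqF //.
have -> : eisnorm X Y = (X - Y / 2) ^+ 2 + 3 / 4 * Y ^+ 2.
  by rewrite /eisnorm; field.
by rewrite ltr_wpDl ?sqr_ge0 // mulr_gt0 ?divr_gt0 ?ltr0n // exprn_even_gt0.
Qed.

Lemma eisnormX0 X : (eisnorm X 0 != 0) = (X != 0).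
Proof. by rewrite /eisnorm mulr0 subr0 expr0n addr0 sqrf_eq0. Qed.

Lemma eisnorm_plus X Y Z W :
  eisnorm (X * W + Z * Y - X * Z) (Y * W - X * Z) = eisnorm X Y * eisnorm Z W.
Proof. by rewrite /eisnorm; ring. Qed.

Lemma eisnorm_inv X Y : eisnorm X (X - Y) = eisnorm X Y.
Proof. by rewrite /eisnorm; ring. Qed.

Lemma hpoint_ex a : exists X Y, eisnorm X Y != 0 /\ a = hpoint X Y.
Proof.
case: a => [x|]; [exists x, 1 | exists 1, 0]; rewrite /hpoint.
- by rewrite oner_eq0 divr1; split => //; apply/eisnorm_neq0/oner_neq0.
- by rewrite eqxx eisnormX0 oner_neq0.
Qed.

(** The right-hand side holds the coordinates of the product
    [(Y + X w)(W + Z w)]. *)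
Lemma hpoint_plus X Y Z W : eisnorm X Y != 0 -> eisnorm Z W != 0 ->
  hpoint X Y [+] hpoint Z W = hpoint (X * W + Z * Y - X * Z) (Y * W - X * Z).
Proof.
rewrite /hpoint; case: (eqVneq Y 0) => [->|Y0]; case: (eqVneq W 0) => [->|W0].
- rewrite !eisnormX0 => X0 Z0 /=.
  rewrite !mulr0 !sub0r addr0 sub0r oppr_eq0 mulf_eq0 (negPf X0) (negPf Z0) /=.
  by rewrite divff // oppr_eq0 mulf_neq0.
- rewrite eisnormX0 => X0 _ /=.
  rewrite mulf_eq0 invr_eq0 (negPf W0) orbF.
  rewrite mul0r sub0r oppr_eq0 mulf_eq0 (negPf X0) /=.
  by case: eqVneq => // Z0; congr Some; field; rewrite X0 Z0 W0.
- rewrite eisnormX0 => _ Z0 /=.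
  rewrite mulf_eq0 invr_eq0 (negPf Y0) orbF.
  rewrite mulr0 sub0r oppr_eq0 mulf_eq0 (negPf Z0) orbF.
  by case: eqVneq => // X0; congr Some; field; rewrite X0 Y0 Z0.
- move=> _ _ /=.
  have E : 1 - X / Y * (Z / W) = (Y * W - X * Z) / (Y * W).
    by field; rewrite Y0 W0.
  have -> : (X / Y * (Z / W) == 1) = (Y * W - X * Z == 0).
    rewrite eq_sym -subr_eq0 E mulf_eq0 invr_eq0 mulf_eq0.
    by rewrite (negPf Y0) (negPf W0) !orbF.
  case: eqVneq => // D0; congr Some; rewrite E.
  by field; rewrite D0 Y0 W0.
Qed.

(** Up to sign, [(X, X - Y)] are the coordinates of the conjugate
    [Y + X w^2 = (Y - X) - X w]. *)
Lemma hpoint_inv X Y : eisnorm X Y != 0 ->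
  boxinv (hpoint X Y) = hpoint X (X - Y).
Proof.
rewrite /hpoint; case: (eqVneq Y 0) => [->|Y0] /=.
  by rewrite eisnormX0 subr0 => X0; rewrite (negPf X0) divff.
move=> _; have E : X / Y - 1 = (X - Y) / Y by field.
rewrite -subr_eq0 E mulf_eq0 invr_eq0 (negPf Y0) orbF.
by case: eqVneq => // D0; congr Some; field; rewrite D0 Y0.
Qed.

Lemma Mbox_hpoint X Y : eisnorm X Y != 0 ->
  Mbox (hpoint X Y) = (eisnorm X Y)^-1 *: Mhom X Y.
Proof.
rewrite /hpoint; case: (eqVneq Y 0) => [->|Y0] /=.
  rewrite eisnormX0 => X0; apply/matrixP => i j; rewrite !mxE /eisnorm.
  by case: i => [[|[|[|//]]] ?]; case: j => [[|[|[|//]]] ?] /=; field.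
move=> N0; have -> : 1 - X / Y + (X / Y) ^+ 2 = eisnorm X Y / Y ^+ 2.
  by rewrite /eisnorm; field.
apply/matrixP => i j; rewrite !mxE.
by case: i => [[|[|[|//]]] ?]; case: j => [[|[|[|//]]] ?] /=;
  field; rewrite N0 Y0.
Qed.

(** The composition of three reflections, cleared of denominators: [(P, Q)] are
    the coordinates of [(Y + X w) * conj(W + Z w)], up to sign, and the last
    matrix belongs to the product of that number with [V + U w]. *)
Lemma Mhom_mul3 X Y Z W U V :
  let P := X * (Z - W) + Z * Y - X * Z in
  let Q := Y * (Z - W) - X * Z in
  Mhom U V *m Mhom Z W *m Mhom X Y = Mhom (P * V + U * Q - P * U) (Q * V - P * U).
Proof.
move=> P Q; rewrite /P /Q; apply/matrixP => i j.
rewrite !mxE !big_ord_recr big_ord0 /= !mxE !big_ord_recr !big_ord0 /= !mxE.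
by case: i => [[|[|[|//]]] ?]; case: j => [[|[|[|//]]] ?] /=; ring.
Qed.

End HomogeneousCoordinates.

Theorem theorem8p1 (R : realType) (rho tau zeta : pline R) :
  (Mbox zeta *m Mbox tau *m Mbox rho = Mbox (rho [+] boxinv tau [+] zeta))%R.
Proof.
have [X [Y [Nr ->]]] := hpoint_ex rho.
have [Z [W [Nt ->]]] := hpoint_ex tau.
have [U [V [Nz ->]]] := hpoint_ex zeta.
have Nt' : eisnorm Z (Z - W) != 0 by rewrite eisnorm_inv.
have Nrt := mulf_neq0 Nr Nt'; rewrite -eisnorm_plus in Nrt.
have Nrtz := mulf_neq0 Nrt Nz; rewrite -eisnorm_plus in Nrtz.
rewrite (hpoint_inv Nt) (hpoint_plus Nr Nt') (hpoint_plus Nrt Nz).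
rewrite (Mbox_hpoint Nrtz) !Mbox_hpoint // !eisnorm_plus eisnorm_inv -Mhom_mul3.
rewrite -!(scalemxAl, scalemxAr) !scalerA.
by congr (_ *: _); field; rewrite Nr Nt Nz.
Qed.
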